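(* Let $X$ be a nonempty countable Polish space. Then $\Theta_X=2\cdot\mathrm{rk}_{\mathrm{CB}}(X)+\varepsilon_X$ for some $\varepsilon_X\in\{-1,0,1\}$.
   Context: Base theory $\mathsf{ZF}+\mathsf{DC}(\mathbb R)$. For $A,B\subseteq X$, $A\le_{\mathsf W}^X B$ means there is a continuous $f\colon X\to X$ with $f^{-1}(B)=A$; $<_{\mathsf W}^X$ is its strict part (which is well-founded here). The Wadge rank is $\mathrm{rk}(A)=\sup(\{1\}\cup\{\mathrm{rk}(B)+1:B<_{\mathsf W}^XA\})$ and $\Theta_X=\sup\{\mathrm{rk}(A)+1:A\subseteq X\}$. $\mathrm{rk}_{\mathrm{CB}}(X)$ is the Cantor–Bendixson rank (least $\alpha$ with $X^{(\alpha)}=X^{(\alpha+1)}$, where $X^{(\alpha)}$ are the iterated Cantor–Bendixson derivatives). $2\cdot\gamma$ denotes ordinal multiplication, and $\gamma+(-1)$ denotes the immediate predecessor of the successor ordinal $\gamma$. *)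

(* Defs.v *)
From mathcomp Require Import all_boot all_order all_algebra.
From mathcomp Require Import boolp classical_sets functions cardinality.
From mathcomp Require Import reals topology.

Set Implicit Arguments.
Unset Strict Implicit.
Unset Printing Implicit Defensive.

Local Open Scope classical_set_scope.

(* [olim f] denotes the least ordinal strictly above all the [f i]. Several
   trees denote the same ordinal, so that equality of ordinals is [oeq] and
   not Leibniz equality. *)
Inductive ord : Type := olim (I : Type) (f : I -> ord).

Definition obranch (a : ord) : Type := let: olim K _ := a in K.
Definition osub (a : ord) : obranch a -> ord :=
  let: olim _ f := a in f.

Fixpoint ole (a b : ord) : Prop :=
  match a, b with
  | olim K f, olim J g => forall i, exists j, ole (f i) (g j)
  end.

Definition olt (a b : ord) : Prop := exists j : obranch b, ole a (osub j).

Definition oeq (a b : ord) : Prop := ole a b /\ ole b a.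

Definition ozero : ord := olim (fun i : void => match i with end).
Definition osucc (a : ord) : ord := olim (fun _ : unit => a).
Definition onat (n : nat) : ord := iter n osucc ozero.

Definition osup (I : Type) (F : I -> ord) : ord :=
  olim (fun p : {i : I & obranch (F i)} => osub (projT2 p)).

Definition omax (a b : ord) : ord := osup (fun c : bool => if c then a else b).

(* a + b = max(a, sup_(c < b) (a + c) + 1), where it suffices to let c range
   over a cofinal family below b. *)
Fixpoint oadd (a b : ord) : ord :=
  let: olim J g := b in omax a (osup (fun j => osucc (oadd a (g j)))).

(* a * b = sup_(c < b) (a * c + a), i.e. b copies of a: 2 * omega = omega. *)
Fixpoint omul (a b : ord) : ord :=
  let: olim J g := b in osup (fun j => oadd (omul a (g j)) a).

(* [is_oadd_int a e c] means c = a + e. When e = - n.+1, this requires a to be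
   an (n.+1)-fold successor, and c is its (n.+1)-fold predecessor. *)
Definition is_oadd_int (a : ord) (e : int) (c : ord) : Prop :=
  match e with
  | Posz n => oeq c (oadd a (onat n))
  | Negz n => oeq (oadd c (onat n.+1)) a
  end.

Lemma ole_refl a : ole a a.
Proof. by elim: a => I f IH /= i; exists i. Qed.

Lemma ole_trans b a c : ole a b -> ole b c -> ole a c.
Proof.
elim: b a c => J g IH [I f] [K h] /= ab bc i.
have [j fg] := ab i; have [k gh] := bc j.
by exists k; apply: IH fg gh.
Qed.

Lemma oleP a b : ole a b <-> forall i : obranch a, olt (osub i) b.
Proof. by case: a b => I f [J g]. Qed.

Lemma olt_branch a (i : obranch a) : olt (osub i) a.
Proof. by exists i; apply: ole_refl. Qed.

Lemma olt_le_trans b a c : olt a b -> ole b c -> olt a c.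
Proof.
move=> [j aj] /oleP /(_ j)[k jk]; exists k; exact: ole_trans jk.
Qed.

Lemma ole_lt_trans b a c : ole a b -> olt b c -> olt a c.
Proof. by move=> ab [k bk]; exists k; apply: ole_trans bk. Qed.

Lemma ole_branch a (i : obranch a) : ole (osub i) a.
Proof.
elim: a i => I f IH i /=; have /= H := fun i => IH i.
apply/oleP => k; apply: (@ole_lt_trans (f i)); first exact: H.
by exists i; apply: ole_refl.
Qed.

Lemma oltW a b : olt a b -> ole a b.
Proof. by move=> [j aj]; apply: ole_trans aj _; apply: ole_branch. Qed.

Lemma olt_wf : well_founded olt.
Proof.
suff H a : forall b, ole b a -> Acc olt b.
  by move=> a; apply: (H a); apply: ole_refl.
elim: a => I f IH b ba; constructor => c cb.
have [i ci] := olt_le_trans cb ba; exact: (IH i).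
Qed.

Lemma olt_irr a : ~ olt a a.
Proof. by elim: (olt_wf a) => b _ IH bb; exact: (IH b). Qed.

Lemma ole_or_lt a b : ole a b \/ olt b a.
Proof.
suff : (ole a b \/ olt b a) /\ (ole b a \/ olt a b) by case.
elim: a b => I f IH b.
have H c : ole (olim f) c \/ olt c (olim f).
  have [|/oleP/existsNP[i fi]] := pselect (ole (olim f) c); first by left.
  right; exists i; have [_ []//] := IH i c.
split=> //.
have [|/oleP/existsNP[j gj]] := pselect (ole b (olim f)); first by left.
by right; exists j; have [] := H (osub j).
Qed.

Lemma oleNlt a b : ~ olt b a -> ole a b.
Proof. by case: (ole_or_lt a b). Qed.

Lemma osuccP a b : ole (osucc a) b <-> olt a b.
Proof. by split=> [/oleP/(_ tt)//|ab]; apply/oleP => -[]. Qed.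

Lemma osup_ub (I : Type) (F : I -> ord) i : ole (F i) (osup F).
Proof.
by apply/oleP => k; exists (existT _ i k); apply: ole_refl.
Qed.

Lemma osup_lub (I : Type) (F : I -> ord) b :
  (forall i, ole (F i) b) -> ole (osup F) b.
Proof. by move=> H; apply/oleP => -[i k]; have /oleP/(_ k) := H i. Qed.

Lemma ord_least (P : ord -> Prop) : (exists a, P a) ->
  exists2 a, P a & forall b, P b -> ole a b.
Proof.
case=> a; elim: (olt_wf a) => {}a _ IH Pa.
have [[b [ba Pb]]|nb] := pselect (exists b, olt b a /\ P b); first exact: IH Pb.
by exists a => // b Pb; apply: oleNlt => ba; apply: nb; exists b.
Qed.

Definition completely_metrizable (R : realType) (X : topologicalType) : Prop :=
  exists M : metricType R,
    (forall F : set_system M, ProperFilter F -> cauchy F -> exists x : M, F --> x) /\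
    exists (f : X -> M) (g : M -> X),
      [/\ continuous f, continuous g, cancel f g & cancel g f].

Definition polish (R : realType) (X : topologicalType) : Prop :=
  (exists2 D : set X, countable D & dense D) /\ completely_metrizable R X.

Section CantorBendixson.
Variable X : topologicalType.

Definition cb_derivative (A : set X) : set X := A `&` limit_point A.

(* X^(a) is the intersection of the derivatives of the X^(c) for c < a; see
   [cb_iter0], [cb_iterS] and [cb_iter_sup] for the usual clauses. *)
Fixpoint cb_iter (a : ord) : set X :=
  let: olim K f := a in \bigcap_(i : K) cb_derivative (cb_iter (f i)).

Lemma cb_iter0 : cb_iter ozero = setT.
Proof. by apply/seteqP; split => // x _ []. Qed.

Lemma cb_iterS a : cb_iter (osucc a) = cb_derivative (cb_iter a).
Proof. by apply/seteqP; split => [x /(_ tt)|x xa []]; [apply|]. Qed.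

Lemma cb_iter_branch a :
  cb_iter a = \bigcap_(i : obranch a) cb_derivative (cb_iter (osub i)).
Proof. by case: a. Qed.

Lemma cb_iter_sup (I : Type) (F : I -> ord) :
  cb_iter (osup F) = \bigcap_(i : I) cb_iter (F i).
Proof.
apply/seteqP; split => [x H i _|x H [i k] _].
  by rewrite cb_iter_branch => k _; apply: (H (existT _ i k)).
by have := H i Logic.I; rewrite cb_iter_branch => /(_ k); apply.
Qed.

Lemma cb_derivativeS (A B : set X) :
  A `<=` B -> cb_derivative A `<=` cb_derivative B.
Proof.
move=> AB x [Ax lA]; split; first exact: AB.
by move=> U /lA[y [yx Ay Uy]]; exists y; split => //; apply: AB.
Qed.

Lemma cb_iter_le a b : ole a b -> cb_iter b `<=` cb_iter a.
Proof.
elim: a b => I f IH [J g] /= ab x xb i _.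
by have [j /IH/cb_derivativeS] := ab i; apply; apply: xb.
Qed.

Definition cb_stable (a : ord) : Prop := cb_iter a = cb_iter (osucc a).

Lemma cb_rank_exists :
  exists a, cb_stable a /\ forall b, cb_stable b -> ole a b.
Proof.
suff /ord_least[a sa la] : exists a, cb_stable a by exists a.
apply/not_existsP => nst.
pose leaves x a := cb_iter a x /\ ~ cb_iter (osucc a) x.
have leavesP a : exists x, leaves x a.
  apply/not_existsP => H; apply: (nst a); apply/seteqP; split => x.
    by move=> xa; apply: contrapT => nx; apply: (H x).
  by rewrite cb_iterS => -[].
pose S := {x | exists a, leaves x a}.
pose f (s : S) : ord := sval (cid (proj2_sig s)).
have [x xl] := leavesP (olim f).
pose s : S := exist _ x (ex_intro _ _ xl).
have [_] : leaves x (f s) by exact: (svalP (cid (proj2_sig s))).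
apply; apply: (@cb_iter_le _ (olim f)); last by have [] := xl.
by apply/osuccP; exists s; apply: ole_refl.
Qed.

Definition cb_rank : ord := sval (cid cb_rank_exists).

Lemma cb_rankP :
  cb_stable cb_rank /\ forall b, cb_stable b -> ole cb_rank b.
Proof. exact: (svalP (cid cb_rank_exists)). Qed.

End CantorBendixson.

Section Wadge.
Variable X : topologicalType.
Implicit Types A B : set X.

Definition wadge_le A B : Prop :=
  exists2 f : X -> X, continuous f & f @^-1` B = A.

Definition wadge_lt A B : Prop := wadge_le A B /\ ~ wadge_le B A.

(* The two branches of the supremum encode {1} and {rk(B)+1 : B <_W A}. *)
Fixpoint wadge_rank_acc A (hA : Acc wadge_lt A) : ord :=
  osup (fun o : option {B | wadge_lt B A} =>
    if o is Some (exist B BA) then osucc (wadge_rank_acc (Acc_inv hA BA))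
    else onat 1).

(* The value outside the well-founded part of [wadge_lt] is irrelevant when
   [wadge_lt] is well-founded; see [wadge_rankE]. *)
Definition wadge_rank A : ord :=
  if pselect (Acc wadge_lt A) is left hA then wadge_rank_acc hA else ozero.

Lemma wadge_rankE A : well_founded wadge_lt ->
  wadge_rank A = osup (fun o : option {B | wadge_lt B A} =>
    if o is Some B then osucc (wadge_rank (sval B)) else onat 1).
Proof.
move=> wf; rewrite {1}/wadge_rank; case: pselect => [[hA]|/(_ (wf A))//] /=.
congr osup; apply/funext => -[[B BA]|//] /=; congr osucc.
rewrite /wadge_rank; case: pselect => [hB|/(_ (wf B))//].
by congr wadge_rank_acc; apply: Prop_irrelevance.
Qed.

Definition wadge_theta : ord := osup (fun A : set X => osucc (wadge_rank A)).

End Wadge.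

(* Main.v *)
Require Import Defs.
From mathcomp Require Import all_boot all_order all_algebra.
From mathcomp Require Import boolp classical_sets functions cardinality.
From mathcomp Require Import reals topology.
From mathcomp Require Import interval_inference ereal normedtype.
From mathcomp Require Import lebesgue_measure.

(* The Hausdorff derivatives of [A], written [alt_iter A b] below, are F_0 = X
   and F_(b+1) = the boundary of [A] relative to F_b. Continuous reductions
   preserve them together with membership in [A]. Conversely, in a countable
   space with a clopen base, [A] reduces to [B] as soon as every pair (level,
   side) realised by [A] is realised by [B]: the reduction is glued from
   countably many clopen pieces, by induction on the level. A point of F_b has
   points of both sides at every lower level arbitrarily close, so each level
   contributes at most two steps to a Wadge chain. Since F_b is contained in
   X^(b), ranks are at most 2 rk_CB(X). For the lower bound, the parity of the
   Cantor-Bendixson rank (truncated at t) yields F_b = X^(b) for b <= t with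
   F_t one-sided, and switching it on a clopen set makes F_t two-sided; these
   sets account for two steps at each level. *)

Set Implicit Arguments.
Unset Strict Implicit.
Unset Printing Implicit Defensive.

Local Open Scope classical_set_scope.

(** * Countable completely metrizable spaces *)

Section PolishSpaces.
Local Open Scope ring_scope.
Import Order.TTheory GRing.Theory Num.Theory.

(** A countable set is Lebesgue null, whereas the interval []0, e[] has measure [e]. *)
Lemma countable_avoid (R : realType) (D : set R) (e : R) :
  countable D -> 0 < e -> exists2 d, 0 < d < e & ~ D d.
Proof.
move=> cD e0; apply: contrapT => H.
have /countable_lebesgue_measure0 : countable [set` `]0, e[%R].
  apply: sub_countable cD; apply: subset_card_le => d.
  rewrite /= in_itv/= => de.
  by apply: contrapT => nD; apply: H; exists d.
by rewrite lebesgue_measure_itv /= lte_fin e0 oppr0 adde0 => -[/eqP];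
  rewrite gt_eqF.
Qed.

Variables (R : realType) (X : topologicalType).

Definition complete_metric (d : X -> X -> R) : Prop :=
  [/\ forall x y, d x y = d y x, forall x y z, d x z <= d x y + d y z,
      forall x y, d x y = 0 <-> x = y,
      forall x U, nbhs x U <-> exists2 e : R, 0 < e & [set y | d x y < e] `<=` U
    & forall F : set_system X, ProperFilter F ->
        (forall e : R, 0 < e -> exists x, F [set y | d x y < e]) ->
        exists x : X, F --> x].

Lemma completely_metrizable_metric :
  completely_metrizable R X -> exists d, complete_metric d.
Proof.
move=> [M [Mc [f [g [cf cg fg gf]]]]]; exists (fun x y => mdist (f x) (f y)).
split.
- by move=> x y; apply: metric_sym.
- by move=> x y z; apply: metric_triangle.
- move=> x y; split=> [/mdist_positivity/(can_inj fg)//|->]; exact: mdistxx.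
- move=> x U; split=> [|[e e0 eU]].
    rewrite -{1}(fg x) => /cg/nbhs_ballP[e e0]; rewrite ballEmdist => eU.
    by exists e => // y /eU /=; rewrite fg.
  apply: filterS eU _; have := cf x _ (nbhsx_ballx (f x) e e0).
  by rewrite ballEmdist.
- move=> F FF Fc; have [|m mF] := Mc (f @ F) _.
    apply: cauchy_exP => e e0; have [x xe] := Fc e e0.
    by exists (f x); rewrite ballEmdist.
  exists (g m) => U /cg/mF /=; rewrite /nbhs /=.
  by apply: filterS => x /=; rewrite fg.
Qed.

Variable d : X -> X -> R.
Hypothesis dP : complete_metric d.
Hypothesis Xcountable : countable [set: X].

Let dC x y : d x y = d y x. Proof. by have [] := dP. Qed.
Let dD y x z : d x z <= d x y + d y z. Proof. by have [] := dP. Qed.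
Let d0 x y : d x y = 0 <-> x = y. Proof. by have [] := dP. Qed.
Let dnbhs x U : nbhs x U <-> exists2 e : R, 0 < e & [set y | d x y < e] `<=` U.
Proof. by have [] := dP. Qed.

Lemma metric_separated (x y : X) : x <> y -> exists2 U, nbhs x U & ~ U y.
Proof.
move=> xy; have dxy : 0 < d x y.
  rewrite lt_neqAle; apply/andP; split; first by apply/eqP => /esym/d0.
  have /d0 xx := erefl x.
  by have := dD y x x; rewrite xx (dC y x) -mulr2n pmulrn_lge0.
exists [set z | d x z < d x y]; last by rewrite /= ltxx.
by apply/dnbhs; exists (d x y).
Qed.

Lemma metric_first_countable (x : X) : exists W : nat -> set X,
  (forall n, nbhs x (W n)) /\
  forall U, nbhs x U -> exists n, forall m, (n <= m)%N -> W m `<=` U.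
Proof.
exists (fun n => [set y | d x y < n.+1%:R^-1]); split=> [n|U /dnbhs[e e0 eU]].
  by apply/dnbhs; exists n.+1%:R^-1 => //; rewrite invr_gt0.
have [n _ nP] := near_infty_natSinv_lt (PosNum e0).
by exists n => m nm y /= /lt_trans - /(_ _ (nP m nm)) /eU.
Qed.

(** Only countably many distances from [x] occur, and an open ball whose radius is not one of them
    is also closed. *)
Lemma countable_metric_clopen (x : X) U : nbhs x U ->
  exists V, [/\ clopen V, V x & V `<=` U].
Proof.
move=> /dnbhs[e e0 eU].
have cD : countable (range (d x)).
  by apply: card_le_trans Xcountable; apply: card_image_le.
have [r /andP[r0 re] nr] := countable_avoid cD e0.
have dr y : d x y <> r by move=> yr; apply: nr; exists y.
exists [set y | d x y < r]; split; [split| |].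
- rewrite openE => y /= yr; apply/dnbhs; exists (r - d x y).
    by rewrite subr_gt0.
  by move=> z /=; rewrite ltrBrDl; apply: le_lt_trans.
- rewrite -openC openE => y /= /negP; rewrite -leNgt => ry; apply/dnbhs.
  exists (d x y - r).
    by rewrite subr_gt0 lt_neqAle ry andbT; apply/eqP => /esym/dr.
  move=> z /= yz xz; have := dD z x y; rewrite leNgt => /negP; apply.
  by rewrite (dC z y) -(subrK r (d x y)) addrC ltrD.
- by have /d0 xx := erefl x; rewrite /= xx.
- by move=> y /= yr; apply: eU; apply: lt_trans yr re.
Qed.

(** A Baire category argument: choose decreasing clopen sets of vanishing size that meet [P], step
    [n] discarding the point of index [n]. Completeness yields a point common to all of them, but
    its own index discards it. *)
Lemma countable_complete_scattered (P : set X) :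
  P `<=` limit_point P -> P = set0.
Proof.
move=> Plim; apply: contrapT => /eqP/set0P[p0 Pp0].
have /countable_injP[idx idx_inj] := Xcountable.
pose ok (V : set X) := clopen V /\ exists p, (V `&` P) p.
have okT : ok setT by split; [apply: clopenT|exists p0].
have /choice[next nextP] (q : {V | ok V} * nat) : exists V' : {V | ok V},
    [/\ sval V' `<=` sval q.1, forall x, sval V' x -> idx x <> q.2
      & exists x, sval V' `<=` [set y | d x y < q.2.+1%:R^-1]].
  case: q => [[V [/= [oV cV] [p [Vp Pp]]]] n] /=.
  (* If [p] is the point to be discarded, another point of [P] in [V] exists because [p] is a limit
     point of [P]. *)
  have [q [Vq Pq qn]] : exists q, [/\ V q, P q & idx q <> n].
    have [pn|] := pselect (idx p = n); last by exists p.
    have [q [/eqP qp Pq Vq]] := Plim p Pp V (open_nbhs_nbhs (conj oV Vp)).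
    exists q; split => // qn; apply: qp; apply: idx_inj; rewrite ?inE//.
    by rewrite qn.
  have [G Gq Gn] : exists2 G, nbhs q G & forall x, G x -> idx x <> n.
    have [[x xn]|nx] := pselect (exists x, idx x = n); last first.
      by exists setT; [exact: filterT|move=> x _ xn; apply: nx; exists x].
    have [|G Gq Gx] := @metric_separated q x.
      by move=> qx; apply: qn; rewrite qx.
    exists G => // y Gy yn; apply: Gx; rewrite (idx_inj x y) ?inE//.
    by rewrite xn.
  have Bq : nbhs q [set y | d q y < n.+1%:R^-1].
    by apply/dnbhs; exists n.+1%:R^-1 => //; rewrite invr_gt0.
  have [V' [cV' V'q V'sub]] := countable_metric_clopen
    (filterI (open_nbhs_nbhs (conj oV Vq)) (filterI Gq Bq)).
  exists (exist _ V' (conj cV' (ex_intro _ q (conj V'q Pq)))); split => /=.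
  - by move=> y /V'sub[].
  - by move=> y /V'sub[_ [/Gn]].
  - by exists q => y /V'sub[_ []].
pose Vs := fix Vs n : {V | ok V} :=
  if n is m.+1 then next (Vs m, m) else exist _ setT okT.
have VsP n := nextP (Vs n, n).
have Vs_le m n : (n <= m)%N -> sval (Vs m) `<=` sval (Vs n).
  elim: m => [|m IH]; first by rewrite leqn0 => /eqP->.
  rewrite leq_eqVlt => /orP[/eqP->//|]; rewrite ltnS => /IH.
  by apply: subset_trans; have [] := VsP m.
have Vs0 n : sval (Vs n) !=set0.
  by have [_ [p [Vp _]]] := svalP (Vs n); exists p.
pose F := filter_from setT (fun n => sval (Vs n)).
have FF : ProperFilter F.
  apply: filter_from_proper; last by move=> n _; apply: Vs0.
  apply: filter_fromT_filter; first by exists 0%N.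
  move=> m n; exists (maxn m n) => y Vy; split; apply: Vs_le Vy;
    [exact: leq_maxl|exact: leq_maxr].
have [_ _ _ _ /(_ F FF)[|x Fx]] := dP.
  move=> e e0; have [n _ nP] := near_infty_natSinv_lt (PosNum e0).
  have [_ _ [x xV]] := VsP n; exists x; exists n.+1 => // y /xV /= /lt_trans.
  by apply; apply: nP => /=.
have xVs n : sval (Vs n) x.
  have [[_ cV] _] := svalP (Vs n); apply: cV => B /Fx[m _ VB].
  have [y Vy] := Vs0 (maxn m n); exists y; split.
    by apply: Vs_le Vy; apply: leq_maxr.
  by apply: VB; apply: Vs_le Vy; apply: leq_maxl.
by have [_ /(_ _ (xVs (idx x).+1))] := VsP (idx x).
Qed.

End PolishSpaces.

(** * Ordinal arithmetic *)

Lemma osuccS a b : ole a b -> ole (osucc a) (osucc b).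
Proof. by move=> ab; apply/oleP => -[]; exists tt. Qed.

Lemma olt_osucc a : olt a (osucc a).
Proof. exact/osuccP/ole_refl. Qed.

Lemma olt_osuccP a b : olt a (osucc b) <-> ole a b.
Proof. by split=> [[[]]//|ab]; exists tt. Qed.

Lemma omax_lub a b c : ole a c -> ole b c -> ole (omax a b) c.
Proof. by move=> ac bc; apply: osup_lub => -[]. Qed.

Lemma oadd_branch a b :
  oadd a b = omax a (osup (fun j => osucc (oadd a (@osub b j)))).
Proof. by case: b. Qed.

Lemma ole_oadd a b : ole a (oadd a b).
Proof.
rewrite oadd_branch.
exact: (@osup_ub _ (fun c : bool => if c then a else _) true).
Qed.

Lemma oadd0 a : oeq (oadd a ozero) a.
Proof.
split; last exact: ole_oadd.
by rewrite oadd_branch; apply: omax_lub (ole_refl a) _; apply: osup_lub => -[].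
Qed.

Lemma oaddS a b : oeq (oadd a (osucc b)) (osucc (oadd a b)).
Proof.
rewrite oadd_branch; split.
  apply: omax_lub; last by apply: osup_lub => i; apply: ole_refl.
  exact: ole_trans (ole_oadd a b) (oltW (olt_osucc _)).
pose F (_ : unit) := osucc (oadd a b).
apply: ole_trans (@osup_ub _ F tt) _.
exact: (@osup_ub _ (fun c : bool => if c then a else osup F) false).
Qed.

Lemma oadd1 a : oeq (oadd a (onat 1)) (osucc a).
Proof.
have [h1 h2] := oaddS a ozero; have [z1 z2] := oadd0 a.
by split; [apply: ole_trans h1 (osuccS z1)|apply: ole_trans (osuccS z2) h2].
Qed.

Lemma oadd2 a : oeq (oadd a (onat 2)) (osucc (osucc a)).
Proof.
have [h1 h2] := oaddS a (onat 1); have [z1 z2] := oadd1 a.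
by split; [apply: ole_trans h1 (osuccS z1)|apply: ole_trans (osuccS z2) h2].
Qed.

Definition odouble (a : ord) : ord := omul (onat 2) a.

Lemma odouble_branch a :
  odouble a = osup (fun i => oadd (odouble (@osub a i)) (onat 2)).
Proof. by case: a. Qed.

Lemma odouble_le a b : ole a b -> ole (odouble a) (odouble b).
Proof.
elim: a b => I f IH b /oleP ab.
rewrite (odouble_branch (olim f)); apply: osup_lub => i.
have [j fj] := ab i; apply: ole_trans (proj1 (oadd2 _)) _.
apply: ole_trans (osuccS (osuccS (IH i _ fj))) _.
apply: ole_trans (proj2 (oadd2 _)) _; rewrite (odouble_branch b).
exact: (@osup_ub _ (fun i => oadd (odouble (@osub b i)) (onat 2))).
Qed.

Lemma odouble_lt a b :
  olt a b -> ole (osucc (osucc (odouble a))) (odouble b).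
Proof.
move=> [j aj]; apply: ole_trans (osuccS (osuccS (odouble_le aj))) _.
rewrite (odouble_branch b); apply: ole_trans (proj2 (oadd2 _)) _.
exact: (@osup_ub _ (fun i => oadd (odouble (@osub b i)) (onat 2))).
Qed.

Lemma odouble_lub a o :
  (forall b, olt b a -> ole (osucc (osucc (odouble b))) o) ->
  ole (odouble a) o.
Proof.
move=> H; rewrite odouble_branch; apply: osup_lub => i.
by apply: ole_trans (proj1 (oadd2 _)) _; apply: H; apply: olt_branch.
Qed.

(* [oodd a] says that [a] has a predecessor which is not odd: limit ordinals
   and [0] are even. *)
Fixpoint oodd (a : ord) : Prop :=
  let: olim K f := a in exists i, (forall j, ole (f j) (f i)) /\ ~ oodd (f i).

(** Parity must not depend on the tree representing an ordinal: a branch attaining the maximum in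
    one tree yields an equal maximal branch in the other. *)
Lemma oodd_oeq a b : oeq a b -> oodd a <-> oodd b.
Proof.
elim: a b => I f IH [J g] [/= fg gf].
split=> [[i [fi nodd]]|[j [gj nodd]]].
  have [j fij] := fg i; have [k gjk] := gf j.
  have gji : ole (g j) (f i) := ole_trans gjk (fi k).
  exists j; split; last by move/(IH i (g j) (conj fij gji)).
  by move=> l; have [m glm] := gf l;
    apply: ole_trans glm (ole_trans (fi m) fij).
have [i gji] := gf j; have [k fik] := fg i.
have fij : ole (f i) (g j) := ole_trans fik (gj k).
exists i; split; last by move/(IH i (g j) (conj fij gji)).
by move=> l; have [m flm] := fg l; apply: ole_trans flm (ole_trans (gj m) gji).
Qed.

Lemma ooddS a : oodd (osucc a) <-> ~ oodd a.
Proof. by split=> [[_ []//]|na]; exists tt; split=> // _; apply: ole_refl. Qed.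

(** * Hausdorff derivatives *)

Section Alternation.
Variable X : topologicalType.
Implicit Types (A B C V : set X) (x y z : X).

(* The boundary of [A] relative to [F]: a point of [F] is always in the closure
   of its own side, so only the opposite side has to be approached. *)
Definition alt_derivative A F : set X :=
  [set x | F x /\
    forall U, nbhs x U -> exists y, [/\ U y, F y & ~ (A y <-> A x)]].

Fixpoint alt_iter A (a : ord) : set X :=
  let: olim K f := a in \bigcap_(i : K) alt_derivative A (alt_iter A (f i)).

Lemma alt_iter_branch A a :
  alt_iter A a = \bigcap_(i : obranch a) alt_derivative A (alt_iter A (osub i)).
Proof. by case: a. Qed.

Lemma alt_derivativeS A F G :
  F `<=` G -> alt_derivative A F `<=` alt_derivative A G.
Proof.
move=> FG x [Fx lx]; split; first exact: FG.
by move=> U /lx[y [Uy Fy yx]]; exists y; split => //; apply: FG.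
Qed.

Lemma alt_iter_le A a b : ole a b -> alt_iter A b `<=` alt_iter A a.
Proof.
elim: a b => I f IH [J g] /= ab x xb i _.
by have [j /IH/alt_derivativeS] := ab i; apply; apply: xb.
Qed.

Lemma alt_iterS A a : alt_iter A (osucc a) = alt_derivative A (alt_iter A a).
Proof. by apply/seteqP; split => [x /(_ tt)|x xa []]; [apply|]. Qed.

Lemma alt_iter_lt A a b :
  olt a b -> alt_iter A b `<=` alt_derivative A (alt_iter A a).
Proof. by move=> /osuccP/alt_iter_le H; rewrite -alt_iterS; apply: H. Qed.

Lemma alt_iter0 A : alt_iter A ozero = setT.
Proof. by apply/seteqP; split => // x _ []. Qed.

(** Points on opposite sides of [A] are distinct, so a relative boundary point is a limit point. *)
Lemma alt_iter_cb A a : alt_iter A a `<=` @cb_iter X a.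
Proof.
elim: a => I f IH x /= xa i _; have [xfi lx] := xa i Logic.I.
split; first exact: IH.
move=> U /lx[y [Uy /IH fy yx]]; exists y; split => //.
by apply/eqP => yxE; apply: yx; rewrite yxE.
Qed.

Lemma open_alt_iterC A a : open (~` alt_iter A a).
Proof.
elim: a => I f IH.
rewrite openE /interior => x /= /existsNP[i] /not_implyP[_ nx].
have [xf|nxf] := pselect (alt_iter A (f i) x); last first.
  have := IH i; rewrite openE => /(_ x nxf); rewrite /interior.
  by apply: filterS => y ny /(_ i Logic.I)[].
(* Being on one side throughout a neighbourhood, within the level, is an open condition. *)
have [U [Ux Ui]] : exists U, nbhs x U /\
    forall y, U y -> alt_iter A (f i) y -> A y <-> A x.
  apply: contrapT => H; apply: nx; split => // U Ux.
  apply: contrapT => H'; apply: H; exists U; split => // y Uy fy.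
  by apply: contrapT => yx; apply: H'; exists y.
move: Ux; rewrite nbhsE => -[W [oW Wx] WU].
exists W => // y Wy /(_ i Logic.I)[fy] /(_ W).
case; first by rewrite nbhsE; exists W.
by move=> z [/WU Wz fz]; apply; rewrite (Ui z)// (Ui y)//; apply: WU.
Qed.

Lemma alt_iter_exact A a z : ~ alt_iter A a z ->
  exists2 b, olt b a & alt_iter A b z /\ ~ alt_iter A (osucc b) z.
Proof.
elim: (olt_wf a) => {}a _ IH.
rewrite {1}alt_iter_branch => /existsNP[i] /not_implyP[_ ni].
have [zi|nzi] := pselect (alt_iter A (osub i) z).
  by exists (osub i); [apply: olt_branch|rewrite alt_iterS].
have [b bi zb] := IH _ (olt_branch i) nzi; exists b => //.
exact: olt_le_trans bi (ole_branch i).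
Qed.

Lemma alt_iter_local A a z : alt_iter A a z -> ~ alt_iter A (osucc a) z ->
  exists2 U, nbhs z U & forall x, U x -> alt_iter A a x -> A x <-> A z.
Proof.
rewrite alt_iterS => za nz; apply: contrapT => H; apply: nz; split => // U Uz.
apply: contrapT => H'; apply: H; exists U => // y Uy fy.
by apply: contrapT => yx; apply: H'; exists y.
Qed.

Lemma alt_iter_preimage A B (f : X -> X) a : continuous f ->
  f @^-1` B = A -> alt_iter A a `<=` f @^-1` alt_iter B a.
Proof.
move=> cf <-; elim: a => I g IH x /= xa i _.
have [xi lx] := xa i Logic.I; split; first exact: (IH i).
move=> U /cf/lx[y [Uy gy yx]]; exists (f y); split => //; exact: (IH i).
Qed.

(** Either [y] itself or nearby points of the opposite side serve. The side is prescribed by a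
    proposition [P], so that it can be that of a point relative to another set. *)
Lemma alt_iter_side B a b y (P : Prop) : olt a b -> alt_iter B b y ->
  forall U, nbhs y U -> exists z, [/\ U z, alt_iter B a z & (P <-> B z)].
Proof.
move=> ab /(alt_iter_lt ab)[ya ly] U Uy.
have [|nP] := pselect (P <-> B y).
  by exists y; split => //; apply: nbhs_singleton.
have [z [Uz az zy]] := ly U Uy; exists z; split => //.
by have [p|p] := pselect P; have [bz|bz] := pselect (B z); tauto.
Qed.

End Alternation.

(** * Wadge reductions and ranks *)

Section Reductions.
Variable X : topologicalType.
Hypothesis Xcountable : countable [set: X].
Hypothesis Xclopen : forall (x : X) U, nbhs x U ->
  exists V, [/\ clopen V, V x & V `<=` U].
Hypothesis Xfirst : forall x : X, exists W : nat -> set X,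
  (forall n, nbhs x (W n)) /\
  forall U, nbhs x U -> exists n, forall m, (n <= m)%N -> W m `<=` U.
Implicit Types (A B C V : set X) (x y z : X).

Lemma enumeration (x0 : X) : exists e : nat -> X, forall x, exists n, e n = x.
Proof.
have /countable_injP[f finj] := Xcountable.
have /choice[e eP] n : exists x, forall x', f x' = n -> x = x'.
  have [[x <-]|H] := pselect (exists x, f x = n).
    by exists x => x' fE; apply: finj; rewrite ?inE.
  by exists x0 => x' fE; case: H; exists x'.
by exists e => x; exists (f x); apply: eP.
Qed.

(* Countability lets us cut [V `\` C] into clopen pieces indexed by [nat]; a
   point of [C] has neighbourhoods missing any given finite number of pieces,
   so continuity there only needs the [n]-th piece to be sent into the [n]-th
   basic neighbourhood of [y]. *)
Lemma glue V C y (Q : X -> X -> Prop) :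
  open V -> open (~` C) ->
  (forall z, V z -> ~ C z -> forall U, nbhs y U -> exists N (g : X -> X),
    nbhs z N /\ forall x, N x ->
      [/\ {for x, continuous g}, C !=set0 -> U (g x) & Q x (g x)]) ->
  (forall x, V x -> C x -> Q x y) ->
  exists f : X -> X, forall x, V x -> {for x, continuous f} /\ Q x (f x).
Proof.
move=> oV oC loc QC.
have [e esurj] := enumeration y; have [Wn [Wnb Wbase]] := Xfirst y.
have /choice[p pP] n : exists q : set X * (X -> X),
  [/\ clopen q.1, q.1 `<=` V `\` C, (V `\` C) (e n) -> q.1 (e n)
    & forall x, q.1 x -> [/\ {for x, continuous q.2},
        C !=set0 -> Wn n (q.2 x) & Q x (q.2 x)]].
  have [[Ve Ce]|nVC] := pselect ((V `\` C) (e n)); last first.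
    by exists (set0, id); split => //; apply: clopen0.
  have [N [g [Ne gP]]] := loc _ Ve Ce _ (Wnb n).
  have [|N' [cN' N'e N'N]] := Xclopen (x := e n) (U := N `&` (V `\` C)).
    apply: filterI => //; apply: open_nbhs_nbhs; split => //.
    by rewrite setDE; apply: openI.
  by exists (N', g); split => //= x /N'N[] // /gP.
pose N n := (p n).1; pose g n := (p n).2.
(* The pieces may overlap, so each point uses the first piece that contains it. *)
pose first z n := N n z /\ forall m, (m < n)%N -> ~ N m z.
have first_ex z n : N n z -> exists m, first z m.
  move=> Nz; have ex : exists m, `[< N m z >] by exists n; apply/asboolP.
  exists (ex_minn ex); case: ex_minnP => m /asboolP Nm mmin; split => // k km.
  by move=> /asboolP/mmin; rewrite leqNgt km.
have first_uniq z n m : first z n -> first z m -> n = m.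
  move=> [Nn nmin] [Nm mmin].
  by have [/mmin/(_ Nn)|/nmin/(_ Nm)|] := ltngtP n m.
pose f z := if pselect (exists n, first z n) is left h
  then g (projT1 (cid h)) z else y.
have fE z n : first z n -> f z = g n z.
  move=> zn; rewrite /f; case: pselect => [h|[]]; last by exists n.
  by case: (cid h) => m /= /first_uniq/(_ zn) ->.
have fC z : (forall n, ~ N n z) -> f z = y.
  by move=> zn; rewrite /f; case: pselect => // h; have [n [/zn]] := h.
have missed n x : (forall m, (m < n)%N -> ~ N m x) ->
    \forall z \near x, forall m, (m < n)%N -> ~ N m z.
  elim: n => [|n IH] nN; first exact: nearW.
  have [/clopenC-/(_ setT)[oN _] _ _ _] := pP n.
  have : nbhs x (~` N n) by apply: open_nbhs_nbhs; split => //; apply: nN.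
  have /IH : forall m, (m < n)%N -> ~ N m x by move=> m mn; apply/nN/ltnW.
  apply: filterS2 => z zN nz m; rewrite ltnS leq_eqVlt => /orP[/eqP->//|].
  exact: zN.
exists f => x Vx.
have [[n /first_ex {n} [n xn]]|nN] := pselect (exists n, N n x).
  have [Nx nmin] := xn; have [[oN _] _ _ /(_ _ Nx)[gc _ Qg]] := pP n.
  rewrite (fE _ _ xn); split => // U; rewrite /= (fE _ _ xn) => /gc.
  have : nbhs x (N n) by apply: open_nbhs_nbhs.
  apply: filterS3 (missed _ _ nmin) => z zmin Nz /=.
  by rewrite /= (fE z n).
have {}nN n : ~ N n x by move=> Nn; apply: nN; exists n.
have Cx : C x.
  apply: contrapT => nCx; have [n en] := esurj x; have [_ _ + _] := pP n.
  by rewrite en => /(_ (conj Vx nCx)); apply: nN.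
rewrite fC//; split; last exact: QC.
move=> U; rewrite /= fC// => Uy; have [n Wn_U] := Wbase U Uy.
(* Near [x] only pieces of index at least [n] are met, and these are sent into basic neighbourhoods
   of [y] inside [U]; points in no piece go to [y]. *)
apply: filterS (missed n x _) => // z zn /=.
have [[m /first_ex {m} [m zm]]|nz] := pselect (exists m, N m z); last first.
  rewrite fC; first exact: nbhs_singleton.
  by move=> m Nm; apply: nz; exists m.
rewrite /= (fE _ _ zm); have [Nm _] := zm.
have [_ _ _ /(_ _ Nm)[_ Wm _]] := pP m.
apply: Wn_U (Wm _); last by exists x.
by rewrite leqNgt; apply/negP => /zn.
Qed.

(** Send the closed set [alt_iter A a] to [y]. A point off it has an exact level below [a], and [y]
    has points of the required side at that level in every neighbourhood, so the induction
    hypothesis supplies the pieces to glue. *)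
Lemma local_reduction A B a V y (W : set X) :
  open V -> (forall x, V x -> alt_iter A a x -> A x <-> B y) ->
  alt_iter B a y -> nbhs y W ->
  exists f : X -> X, forall x, V x ->
    {for x, continuous f} /\ (W (f x) /\ (A x <-> B (f x))).
Proof.
elim: (olt_wf a) V y W => {}a _ IH V y W oV side ya Wy.
apply: (@glue V (alt_iter A a) y (fun x x' => W x' /\ (A x <-> B x'))) => //.
- exact: open_alt_iterC.
- move=> z Vz nz U Uy.
  have [b ba [zb nzb]] := alt_iter_exact nz.
  have [G Gz Gside] := alt_iter_local zb nzb.
  have [y' [UWy' y'b zy']] :=
    alt_iter_side (A z) ba ya (nbhs_interior (filterI Uy Wy)).
  have [N [[oN _] Nz NG]] := Xclopen Gz.
  have [|g gP] := IH b ba N y' (U `&` W) oN _ y'b UWy'.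
    by move=> x Nx xb; rewrite (Gside x)//; apply: NG.
  exists N, g; split; first exact: open_nbhs_nbhs.
  by move=> x /gP[gc [[Ug Wg] ABx]].
- by move=> x Vx ax; split; [apply: nbhs_singleton|apply: side].
Qed.

(** Necessity holds since reductions preserve levels and sides. For sufficiency, [A] is one-sided on
    the exact level of [z] near [z], which gives a local reduction there; these are glued. *)
Lemma wadge_leP A B : (forall z, exists b, ~ alt_iter A b z) ->
  wadge_le A B <-> forall b z, alt_iter A b z ->
    exists2 y, alt_iter B b y & A z <-> B y.
Proof.
move=> Aexh; split=> [[f cf fBA] b z zb|H].
  exists (f z); first exact: (alt_iter_preimage cf fBA).
  by rewrite -fBA.
have [[y0 _]|noX] := pselect (exists y : X, True); last first.
  exists id; first by move=> x; case: noX; exists x.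
  by apply/seteqP; split => x; case: noX; exists x.
(* With an empty exceptional set, the gluing demands no convergence to [y0]. *)
have [||||f fP] := @glue setT set0 y0 (fun x x' => A x <-> B x') => //.
- exact: openT.
- by rewrite setC0; apply: openT.
- move=> z _ _ U _; have [a /alt_iter_exact[b _ [zb nzb]]] := Aexh z.
  have [G Gz Gside] := alt_iter_local zb nzb.
  have [y yb zy] := H b z zb.
  have [N [[oN _] Nz NG]] := Xclopen Gz.
  have [||g gP] := @local_reduction A B b N y setT oN _ yb.
  + by move=> x Nx xb; rewrite (Gside x)//; apply: NG.
  + exact: filterT.
  exists N, g; split; first exact: open_nbhs_nbhs.
  by move=> x /gP[gc [_ ABx]]; split => // -[].
exists f; first by move=> x; have [] := fP x Logic.I.
apply/seteqP; split => x; have [_ ABx] := fP x Logic.I; first by move/ABx.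
by move=> Ax; apply/ABx.
Qed.

(** * Well-foundedness and the upper bound on Wadge ranks *)

Hypothesis Xscattered : forall P : set X, P `<=` limit_point P -> P = set0.

Lemma cb_iter_rank : @cb_iter X (cb_rank X) = set0.
Proof.
have [st _] := cb_rankP X; apply: Xscattered => x.
by rewrite {1}st cb_iterS => -[].
Qed.

Lemma cb_iter_lt_rank b x : cb_iter b x -> olt b (cb_rank X).
Proof.
move=> xb; have [|//] := ole_or_lt (cb_rank X) b.
by move=> /cb_iter_le/(_ _ xb); rewrite cb_iter_rank.
Qed.

Lemma alt_iter_vanish A z : exists b, ~ alt_iter A b z.
Proof.
by exists (cb_rank X) => /alt_iter_cb; rewrite cb_iter_rank.
Qed.

(* An upper bound for the Wadge rank: a single side of [A] at level [b] counts
   for [2 b + 1], both sides for [2 b + 2]. *)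
Definition alt_bound A (o : ord) : Prop := forall b z, alt_iter A b z ->
  ole (osucc (odouble b)) o /\
  ((exists2 z', alt_iter A b z' & ~ (A z' <-> A z)) ->
    ole (osucc (osucc (odouble b))) o).

(** Some side of [A] at some level [b] is missed by [B]. So [B] has no point above level [b], where
    both sides would be near. If [B] has a point at level [b], its bound is [2 b + 1] while [A] has
    both sides there; otherwise its bound is [2 b], while [A] has at least one side. *)
Lemma alt_bound_lt A B o : alt_bound A o -> wadge_lt B A ->
  exists2 o', olt o' o & alt_bound B o'.
Proof.
move=> Ao [/(wadge_leP _ (alt_iter_vanish B)) BA AB].
have [b [z [zb nob]]] : exists b z, alt_iter A b z /\
    forall y, alt_iter B b y -> ~ (A z <-> B y).
  apply: contrapT => H; apply: AB; apply/(wadge_leP _ (alt_iter_vanish A)).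
  move=> b z zb; apply: contrapT => H'; apply: H; exists b, z; split => //.
  by move=> y yb zy; apply: H'; exists y.
have ub c y : alt_iter B c y -> ole c b.
  move=> yc; apply: oleNlt => bc.
  have [y' [_ y'b zy']] := alt_iter_side (A z) bc yc filterT.
  exact: nob y'b zy'.
have [zo zoo] := Ao b z zb.
have [[y yb]|noy] := pselect (exists y, alt_iter B b y).
  exists (osucc (odouble b)).
    apply: olt_le_trans (olt_osucc _) (zoo _).
    have [y' y'b yy'] := BA b y yb; exists y' => //.
    by move=> y'z; apply: nob yb _; tauto.
  move=> c x xc; split; first exact/osuccS/odouble_le/(ub _ _ xc).
  move=> [x' x'c xx']; apply: ole_trans (oltW (olt_osucc _)).
  apply: odouble_lt; have [bc|//] := ole_or_lt b c.
  have := nob _ (alt_iter_le bc xc); have := nob _ (alt_iter_le bc x'c).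
  have [] := pselect (A z); have [] := pselect (B x);
    have [] := pselect (B x'); tauto.
exists (odouble b); first exact/osuccP.
move=> c x xc; have cb : olt c b.
  by have [bc|//] := ole_or_lt b c; case: noy; exists x; apply: alt_iter_le xc.
split=> [|_]; last exact: odouble_lt.
exact: ole_trans (oltW (olt_osucc _)) (odouble_lt cb).
Qed.

Lemma alt_bound_acc A o : alt_bound A o -> Acc (@wadge_lt X) A.
Proof.
elim: (olt_wf o) A => {}o _ IH A Ao; constructor => B BA.
by have [o' /IH o'IH /o'IH] := alt_bound_lt Ao BA.
Qed.

Lemma alt_bound_cb_rank A : alt_bound A (odouble (cb_rank X)).
Proof.
move=> b z /alt_iter_cb/cb_iter_lt_rank/odouble_lt H; split=> [|_ //].
exact: ole_trans (oltW (olt_osucc _)) H.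
Qed.

Lemma wadge_lt_wf : well_founded (@wadge_lt X).
Proof. by move=> A; apply: alt_bound_acc (@alt_bound_cb_rank A). Qed.

Lemma wadge_rank_le A o x : alt_bound A o -> ole (wadge_rank A) o.
Proof.
elim: (olt_wf o) A => {}o _ IH A Ao; rewrite (wadge_rankE _ wadge_lt_wf).
apply: osup_lub => -[[B BA]|].
  apply/osuccP; have [o' o'o Bo'] := alt_bound_lt Ao BA.
  exact: ole_lt_trans (IH _ o'o _ Bo') o'o.
(* Ranks start at 1; the point [x] at level 0 forces [o] to be at least 1. *)
have [|H _] := Ao ozero x; first by rewrite alt_iter0.
by apply: ole_trans H; apply: osuccS; apply/oleP => -[].
Qed.

(** * The lower bound by parity sets *)

Lemma wadge_rank_lt A B :
  wadge_lt B A -> ole (osucc (wadge_rank B)) (wadge_rank A).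
Proof.
move=> BA; rewrite (wadge_rankE A wadge_lt_wf).
exact: (@osup_ub _ (fun o : option {B | wadge_lt B A} =>
  if o is Some B then osucc (wadge_rank (sval B)) else onat 1)
  (Some (exist _ B BA))).
Qed.

(* The points whose Cantor-Bendixson rank, truncated at [t], is odd. *)
Definition parity_set (t : ord) : set X := [set x | exists c,
  [/\ ole c t, cb_iter c x, oodd c &
      forall b, ole b t -> cb_iter b x -> ole b c]].

(** The last hypothesis makes [c] the truncated rank of [x]: either [x] disappears right after stage
    [c], or the truncation stops there. *)
Lemma parity_setE t c x : ole c t -> cb_iter c x ->
  ~ cb_iter (osucc c) x \/ ole t c -> parity_set t x <-> oodd c.
Proof.
move=> ct xc top.
have cmax b : ole b t -> cb_iter b x -> ole b c.
  move=> bt xb; apply: oleNlt => cb; case: top => [nxc|tc].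
    by apply: nxc; apply: cb_iter_le xb; apply/osuccP.
  exact: olt_irr (olt_le_trans cb (ole_trans bt tc)).
split=> [[d [dt xd od dmax]]|oc]; last by exists c.
have cd : oeq d c by split; [apply: cmax|apply: dmax].
by move: od => /(oodd_oeq cd).
Qed.

(** Otherwise the trace of [cb_iter c] on an open neighbourhood of [x] would be nonempty without
    isolated points, against scatteredness. *)
Lemma cb_iter_exact_dense c x (U : set X) : cb_iter (osucc c) x -> nbhs x U ->
  exists y, [/\ U y, cb_iter c y & ~ cb_iter (osucc c) y].
Proof.
move=> xc Ux; apply: contrapT => H.
move: (Ux); rewrite nbhsE => -[W [oW Wx] WU].
suff W0 : W `&` cb_iter c = set0.
  have : (W `&` cb_iter c) x by split => //; move: xc; rewrite cb_iterS => -[].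
  by rewrite W0.
apply: Xscattered => p [Wp pc] G Gp.
have : cb_iter (osucc c) p.
  by apply: contrapT => np; apply: H; exists p; split => //; apply: WU.
have GWp : nbhs p (G `&` W) by apply: filterI => //; apply: open_nbhs_nbhs.
rewrite cb_iterS => -[_ /(_ _ GWp)[y [yp yc [Gy Wy]]]].
by exists y; split.
Qed.

Lemma parity_set_iter t b : ole b t -> cb_iter b `<=` alt_iter (parity_set t) b.
Proof.
elim: b => I f IH bt x xb i _.
have ct : olt (f i) t := olt_le_trans (@olt_branch (olim f) i) bt.
have xc : cb_iter (osucc (f i)) x by rewrite cb_iterS; apply: (xb i).
have sub y : cb_iter (f i) y -> alt_iter (parity_set t) (f i) y.
  by apply: IH; apply: oltW.
split; first by apply: sub; move: xc; rewrite cb_iterS => -[].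
move=> U Ux.
have [y [Uy yc ny]] := cb_iter_exact_dense xc Ux.
have yodd := parity_setE (oltW ct) yc (or_introl ny).
have [xodd|xodd] := pselect (parity_set t y <-> parity_set t x); last first.
  by exists y; split => //; apply: sub.
(* Here [y] is on the side of [x]. Either nearby points of exact rank one higher have the opposite
   parity, or [x] itself has that truncated rank, which contradicts the equality of sides. *)
have [|nx] := pselect (cb_iter (osucc (osucc (f i))) x /\ olt (osucc (f i)) t).
  move=> [xcc ct']; have [z [Uz zc nz]] := cb_iter_exact_dense xcc Ux.
  have zodd := parity_setE (oltW ct') zc (or_introl nz).
  exists z; split => //.
    by apply: sub; move: zc; rewrite cb_iterS => -[].
  by have := ooddS (f i); tauto.
have xodd' : parity_set t x <-> oodd (osucc (f i)).
  apply: parity_setE => //; first exact/osuccP.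
  have [tc|ct'] := ole_or_lt t (osucc (f i)); first by right.
  by left => xcc; apply: nx.
by have := ooddS (f i); tauto.
Qed.

(** A clopen set is locally constant, so switching sides on it leaves unchanged which nearby points
    are on opposite sides. *)
Lemma alt_iter_flip A V a : clopen V ->
  alt_iter [set x | A x <-> V x] a = alt_iter A a.
Proof.
move=> cV; have Vloc x : nbhs x [set y | V y <-> V x].
  have [oV _] := cV; have [oVc _] := clopenC setT cV.
  have [Vx|nVx] := pselect (V x).
    by apply: filterS (open_nbhs_nbhs (conj oV Vx)) => y Vy.
  by apply: filterS (open_nbhs_nbhs (conj oVc nVx)) => y Vy; split.
elim: a => I f IH /=; apply: eq_bigcapr => i _; rewrite IH.
apply/seteqP; split => x [Fx lx]; split => // U Ux;
  have [y [[Uy yx] Fy xy]] := lx _ (filterI Ux (Vloc x));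
  exists y; split => //; move: yx xy => /=;
  have [] := pselect (A x); have [] := pselect (A y);
  have [] := pselect (V x); have [] := pselect (V y); tauto.
Qed.

Hypothesis Xseparated : forall x y : X, x <> y -> exists2 U, nbhs x U & ~ U y.

(** For each [t] below [s], two strict steps [C < C' < A] are found: [C] is one-sided at its last
    level [t], [C'] two-sided there, and [A] reaches level [t + 1]. By induction [C] has rank at
    least [2 t]. *)
Lemma wadge_rank_ge A s z :
  alt_iter A s z -> ole (odouble s) (wadge_rank A).
Proof.
elim: (olt_wf s) A z => {}s _ IH A z zs; apply: odouble_lub => t ts.
have zt : alt_iter A (osucc t) z by apply: alt_iter_le zs; apply/osuccP.
have zcb := alt_iter_cb zt.
have [zcbt lz] : cb_derivative (cb_iter t) z by rewrite -cb_iterS.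
(* A second point of stage [t], to be separated from [z] by the clopen set [V]. *)
have [x0 [/eqP x0z x0t _]] := lz setT filterT.
have [G Gx0 Gz] := Xseparated x0z.
have [V [cV Vx0 VG]] := Xclopen Gx0.
pose C := parity_set t; pose C' : set X := [set x | C x <-> V x].
have C'C a : alt_iter C' a = alt_iter C a by apply: alt_iter_flip.
have Cside x y : cb_iter t x -> cb_iter t y -> C x <-> C y.
  move=> xt yt; have tt := ole_refl t.
  have := parity_setE tt xt (or_intror tt).
  by have := parity_setE tt yt (or_intror tt); rewrite /C; tauto.
have Cub b x : alt_iter C b x -> ole b t.
  move=> xb; apply: oleNlt => /alt_iter_lt/(_ _ xb)[xt lx].
  have [y [_ yt]] := lx setT filterT; apply.
  by apply: Cside; apply: alt_iter_cb; eassumption.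
have Ct x : cb_iter t x -> alt_iter C t x.
  by apply: parity_set_iter; apply: ole_refl.
have sides : ~ (C' x0 <-> C' z).
  have := Cside _ _ x0t zcbt; have : ~ V z by move/VG.
  by rewrite /C' /=; tauto.
have CC' : wadge_lt C C'.
  split; first apply/(wadge_leP _ (alt_iter_vanish C)).
    move=> b x xb; have bt := Cub _ _ xb; rewrite C'C.
    have [Cx|nCx] := pselect (C x <-> C' x0).
      by exists x0 => //; apply: alt_iter_le bt _ _; apply: Ct.
    exists z; first by apply: alt_iter_le bt _ _; apply: Ct.
    have [] := pselect (C x); have [] := pselect (C' x0);
      have [] := pselect (C' z); tauto.
  move=> /(wadge_leP _ (alt_iter_vanish C')) H.
  have [|y0 y0t Cy0] := H t x0; first by rewrite C'C; apply: Ct.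
  have [|y1 y1t Cy1] := H t z; first by rewrite C'C; apply: Ct.
  have := Cside _ _ (alt_iter_cb y0t) (alt_iter_cb y1t).
  by move: sides; tauto.
have C'A : wadge_lt C' A.
  split; first apply/(wadge_leP _ (alt_iter_vanish C')).
    move=> b x; rewrite C'C => xb; have bt := Cub _ _ xb.
    have [y [_ yt xy]] := alt_iter_side (C' x) (olt_osucc t) zt filterT.
    by exists y => //; apply: alt_iter_le yt.
  move=> /(wadge_leP _ (alt_iter_vanish A))/(_ _ _ zt)[y + _].
  by rewrite C'C => /Cub/osuccP/olt_irr.
apply: ole_trans (wadge_rank_lt C'A); apply: osuccS.
apply: ole_trans (wadge_rank_lt CC'); apply: osuccS.
exact: IH ts _ _ (Ct _ x0t).
Qed.

Lemma wadge_theta_bounds (x : X) :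
  ole (wadge_theta X) (osucc (odouble (cb_rank X))) /\
  forall s, olt s (cb_rank X) -> ole (osucc (odouble s)) (wadge_theta X).
Proof.
split=> [|s sr].
  apply: osup_lub => A; apply: osuccS.
  exact: wadge_rank_le x (@alt_bound_cb_rank A).
(* An empty stage would be stable, against the minimality of the rank. *)
have [y ys] : exists y : X, cb_iter s y.
  apply: contrapT => /forallNP H; have [_ /(_ s) rs] := cb_rankP X.
  apply: (olt_irr (olt_le_trans sr (rs _))).
  by apply/seteqP; split => [y /H//|y]; rewrite cb_iterS => -[/H].
have Ay := parity_set_iter (ole_refl s) ys.
apply: ole_trans (osuccS (wadge_rank_ge Ay)) _.
exact: (@osup_ub _ (fun A : set X => osucc (wadge_rank A))).
Qed.

End Reductions.

(** * The three possible values of the length of the Wadge order *)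

Local Open Scope ring_scope.

Theorem theorem4p15 (R : realType) (X : topologicalType)
    (Xpolish : polish R X)
    (Xcountable : countable [set: X])
    (Xnonempty : [set: X] !=set0) :
  exists2 e : int, e \in [:: -1; 0; 1] &
    is_oadd_int (omul (onat 2) (cb_rank X)) e (wadge_theta X).
Proof.
have [_ /completely_metrizable_metric[d dP]] := Xpolish.
have [x _] := Xnonempty.
have [theta_le theta_ge] := wadge_theta_bounds Xcountable
  (countable_metric_clopen dP Xcountable) (metric_first_countable dP)
  (countable_complete_scattered dP Xcountable) (metric_separated dP) x.
rewrite -/(odouble _).
have [a0 a0'] := oadd0 (odouble (cb_rank X)).
have [a1 a1'] := oadd1 (odouble (cb_rank X)).
have [b1 b1'] := oadd1 (wadge_theta X).
have [gt|/olt_osuccP le] :=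
  ole_or_lt (osucc (odouble (cb_rank X))) (wadge_theta X).
  exists 1 => //; split; first exact: ole_trans theta_le a1'.
  exact: ole_trans a1 gt.
have [ge|lt] := ole_or_lt (odouble (cb_rank X)) (wadge_theta X).
  exists 0 => //; split; first exact: ole_trans le a0'.
  exact: ole_trans a0 ge.
exists (-1) => //; split.
  by apply: ole_trans b1 _; apply/osuccP.
(* Each [s] below the rank satisfies [2 s + 2 <= theta + 1]; the supremum of the left sides is twice
   the rank. *)
by apply: ole_trans b1'; apply: odouble_lub => s /theta_ge/osuccS.
Qed.
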